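(* Let $f(x),g(x)\in\mathbb{Z}[x]$ be non-zero polynomials. Let $r=\gcd(\mathrm{cont}(f),\mathrm{cont}(g))$, let $w$ be the gcd of the leading coefficients of $f$ and $g$, let $A=A_{\mathrm{pp}(f),\mathrm{pp}(g)}$, and let $k$ be the largest number for which $p_k\#\le A$. Let $q_1,\dots,q_{k+1}$ be any pairwise distinct primes none of which divides $w$. Then $f$ and $g$ are coprime in $\mathbb{Z}[x]$ if and only if $r=\pm1$ and there is at least one $i\in\{1,\dots,k+1\}$ such that the reductions of $\mathrm{pp}(f)$ and $\mathrm{pp}(g)$ modulo $q_i$ have a gcd of degree $0$ in $\mathbb{Z}_{q_i}[x]$. Accordingly, the following procedure detects whether $f$ and $g$ are coprime: first output ''not coprime'' and stop if $r\ne\pm1$; otherwise compute these modular gcd's (by the Euclidean algorithm) for $i=1,\dots,k+1$, output ''coprime'' and stop as soon as one of them has degree $0$, and output ''not coprime'' if none of them has.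
   Context: For a non-zero $u(x)=u_0x^n+\cdots+u_n\in\mathbb{Z}[x]$ with $u_0\ne0$, $\|u\|=\sqrt{\sum_{i=0}^n u_i^2}$, $\mathrm{cont}(u)$ is the gcd of the coefficients and $\mathrm{pp}(u)=u/\mathrm{cont}(u)$ (both defined up to sign). For polynomials $u,v$ of degrees $n$ and $m$, $$A_{u,v}=2^{2nm-n-m}\sqrt{(n+1)^m(m+1)^n}\cdot\|u\|^m\|v\|^n .$$ $p_k\#=p_1p_2\cdots p_k$ is the product of the first $k$ primes ($p_1=2$, $p_2=3$, ...). Two polynomials in $\mathbb{Z}[x]$ are coprime if their gcd in $\mathbb{Z}[x]$ is $\pm1$. $\mathbb{Z}_q$ denotes the field of residues modulo the prime $q$; reduction modulo $q$ is coefficientwise. *)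

(* Defs.v *)
From HB Require Import structures.
From mathcomp Require Import all_boot all_order all_algebra.

Set Implicit Arguments.
Unset Strict Implicit.
Unset Printing Implicit Defensive.

Import Order.TTheory GRing.Theory Num.Theory.
Local Open Scope ring_scope.

Lemma ex_prime_above (n : nat) : exists p : nat, (n < p)%N && prime p.
Proof. by have [p lt_np p_pr] := prime_above n; exists p; rewrite lt_np. Qed.

Definition next_prime (n : nat) : nat := ex_minn (ex_prime_above n).

(* The i-th prime, counted from nth_prime 1 = 2; the value nth_prime 0 = 0 is
   only the starting point of the iteration. *)
Definition nth_prime (i : nat) : nat := iter i next_prime 0%N.

Definition primorial (k : nat) : nat := (\prod_(1 <= i < k.+1) nth_prime i)%N.

Definition deg (A : nzRingType) (u : {poly A}) : nat := (size u).-1.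

Definition poly_norm (R : rcfType) (u : {poly int}) : R :=
  Num.sqrt (\sum_(i < size u) (u`_i)%:~R ^+ 2).

(* The power of 2 has an integer exponent, which is negative when exactly one
   of u and v is constant. *)
Definition bound (R : rcfType) (u v : {poly int}) : R :=
  let n := deg u in
  let m := deg v in
  2%:R ^ (2 * n%:Z * m%:Z - n%:Z - m%:Z)
  * Num.sqrt ((n.+1 ^ m * m.+1 ^ n)%N%:R)
  * poly_norm R u ^+ m * poly_norm R v ^+ n.

(* k is the largest natural number with primorial k <= a, where k = 0 if there
   is none, that is, if a < 1 = primorial 0. For a = bound u v with u and v
   primitive, the latter happens exactly when one of u and v is constant and
   the other is not. *)
Definition largest_primorial_index (R : rcfType) (a : R) (k : nat) : Prop :=
  (k = 0%N \/ (primorial k)%:R <= a)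
  /\ (forall j : nat, (primorial j)%:R <= a -> (j <= k)%N).

(* Divisibility in the ring Z[x]. The relation %| on {poly int} is
   pseudo-divisibility, which ignores non-zero integer factors. *)
Definition dvdZX (d u : {poly int}) : Prop := exists h : {poly int}, u = d * h.

Definition is_gcdZX (d u v : {poly int}) : Prop :=
  [/\ dvdZX d u, dvdZX d v
    & forall e : {poly int}, dvdZX e u -> dvdZX e v -> dvdZX e d].

Definition coprimeZX (u v : {poly int}) : Prop :=
  exists d : {poly int}, is_gcdZX d u v /\ (d = 1 \/ d = -1).

(* cont and pp are the library's zcontents and zprimitive, whose sign is
   normalised so that pp(u) has a positive leading coefficient. *)
Definition cont_gcd (f g : {poly int}) : int :=
  gcdz (zcontents f) (zcontents g).

Definition lead_gcd (f g : {poly int}) : int :=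
  gcdz (lead_coef f) (lead_coef g).

(* 'F_q is the field of residues modulo q only for prime q. *)
Definition red_mod (q : nat) (u : {poly int}) : {poly 'F_q} :=
  map_poly (intr : int -> 'F_q) u.

(* gcdp over a field is the result of the Euclidean algorithm. *)
Definition mod_gcd (q : nat) (u v : {poly int}) : {poly 'F_q} :=
  gcdp (red_mod q u) (red_mod q v).

(* Degree 0 means size 1; the zero polynomial, of size 0, is excluded. *)
Definition deg0 (A : nzRingType) (u : {poly A}) : bool := size u == 1%N.

Inductive verdict : Type := Coprime | NotCoprime.

Fixpoint modular_search (u v : {poly int}) (qs : seq nat) : verdict :=
  if qs is q :: qs' then
    if deg0 (mod_gcd q u v) then Coprime else modular_search u v qs'
  else NotCoprime.

Definition coprimality_procedure (f g : {poly int}) (qs : seq nat) : verdict :=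
  if (cont_gcd f g != 1) && (cont_gcd f g != -1) then NotCoprime
  else modular_search (zprimitive f) (zprimitive g) qs.

(* Main.v *)
Require Import Defs.
From HB Require Import structures.
From mathcomp Require Import all_boot all_order all_algebra.
From mathcomp Require Import perm zify.

Set Implicit Arguments.
Unset Strict Implicit.
Unset Printing Implicit Defensive.

Import Order.TTheory GRing.Theory Num.Theory.
Local Open Scope ring_scope.

(** Write u = pp(f) and v = pp(g). Over the rationals f and g have a common
    factor of positive degree exactly when the resultant of u and v vanishes, so
    by Gauss's lemma coprimality in Z[x] amounts to r = 1 and Res(u, v) <> 0.

    One good prime suffices for coprimality ([coprimeZX_mod]): a common divisor
    e of f and g has a leading coefficient dividing w, so a prime q not dividing
    w preserves the degree of pp(e), which divides the modular gcd. If the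
    latter has degree 0, then e is a constant dividing r.

    Conversely ([has_deg0_mod_gcd]), let f and g be coprime, of degrees
    n, m >= 1. Since Res(u, v) is a combination of u and v with coefficients in
    Z[x], every prime q for which the modular gcd does not have degree 0 divides
    Res(u, v) ([deg0_mod_gcd_resultant]). If all k+1 distinct primes did,
    their product, which is at least the product of the first k+1 primes
    ([primorial_le_prod]), would divide the nonzero integer Res(u, v); but
    |Res(u, v)| <= A ([resultant_le_bound]), against the maximality of k.

    The bound on the resultant does without Hadamard's inequality. Expanding the
    product of the l1-norms of the rows of a matrix gives, among other
    nonnegative terms, the absolute value of each term of the Leibniz formula.
    For the Sylvester matrix this yields ||u||_1^m ||v||_1^n, and Cauchy-Schwarz
    turns the l1-norms into Euclidean norms at the cost of exactly the square
    root that occurs in A. The power of 2 in A is at least 1 for n, m >= 1. When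
    u or v is constant, that polynomial is 1, so every modular gcd has
    degree 0. *)

(** * Size of the resultant *)

(** Expanding the product of the row sums gives one term for each map from row
    to column indices; the injective maps give the Leibniz terms. *)
Lemma ler_norm_det (R : numDomainType) (n : nat) (A : 'M[R]_n) :
  `|\det A| <= \prod_i \sum_j `|A i j|.
Proof.
apply: le_trans (ler_norm_sum _ _ _) _.
rewrite bigA_distr_bigA /= (bigID (fun f : {ffun _} => injectiveb f)) /=.
rewrite -[leLHS]addr0; apply: lerD; last first.
  by apply: sumr_ge0 => f _; apply: prodr_ge0.
rewrite [leRHS](reindex (@pval _)) /=; last first.
  pose in_Sn := insubd (1%g : 'S_n).
  by exists in_Sn => /= s s_inj; first apply: val_inj; apply: insubdK.
(* The sum over the injective maps is the Leibniz sum of absolute values. *)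
rewrite le_eqVlt; apply/orP; left; apply/eqP.
apply: eq_big => /= [s | s _]; first by rewrite (valP s).
by rewrite normrM normr_sign mul1r normr_prod; under eq_bigr do rewrite -pvalE.
Qed.

Definition poly_l1norm (A : numDomainType) (p : {poly A}) : A :=
  \sum_(i < size p) `|p`_i|.

Lemma ler_sum_coef (A : numDomainType) (p : {poly A}) (N : nat) :
  \sum_(0 <= i < N) `|p`_i| <= poly_l1norm p.
Proof.
rewrite /poly_l1norm -(big_mkord xpredT (fun i => `|p`_i|)).
have [le_Np | /ltnW le_pN] := leqP N (size p).
  rewrite [leRHS](big_cat_nat (n := N)) //= lerDl.
  exact: sumr_ge0.
rewrite (big_cat_nat (n := size p)) //= [X in _ + X]big_nat.
rewrite [X in _ + X]big1 ?addr0 // => i.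
by case/andP=> le_pi _; rewrite nth_default ?normr0.
Qed.

(** The left side is the l1-norm of row k of a block of the Sylvester matrix. *)
Lemma ler_sum_coef_shift (A : numDomainType) (p : {poly A}) (N k : nat) :
  \sum_(j < N) `|p`_(j - k) *+ (k <= j)| <= poly_l1norm p.
Proof.
rewrite -(big_mkord xpredT (fun j => `|p`_(j - k) *+ (k <= j)|)).
apply: le_trans (ler_sum_coef p (N - k)).
have -> : \sum_(0 <= i < N - k) `|p`_i| = \sum_(k <= j < N) `|p`_(j - k)|.
  rewrite -{2}[k]add0n big_addn; apply: eq_bigr => i _.
  by rewrite addnK.
have [le_kN | lt_Nk] := leqP k N.
  rewrite (big_cat_nat (n := k)) //= [X in X + _]big_nat.
  rewrite [X in X + _]big1 ?add0r => [|j].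
    by apply: ler_sum_nat => j /andP[-> _]; rewrite mulr1n.
  by move=> /andP[_ lt_jk]; rewrite leqNgt lt_jk normr0.
rewrite [leRHS]big_geq ?(ltnW lt_Nk) // big_nat big1 // => j /andP[_ lt_jN].
by rewrite leqNgt (ltn_trans lt_jN lt_Nk) normr0.
Qed.

(** Each row of the Sylvester matrix is a shift of the coefficients of p or of
    q, so its l1-norm is at most that of the polynomial. *)
Lemma ler_norm_resultant (A : numDomainType) (p q : {poly A}) :
  `|resultant p q| <= poly_l1norm p ^+ deg q * poly_l1norm q ^+ deg p.
Proof.
apply: le_trans (ler_norm_det _) _.
rewrite big_split_ord /= -[X in _ ^+ X * _]card_ord -[X in _ * _ ^+ X]card_ord.
rewrite -!prodr_const.
apply: ler_pM; try by apply: prodr_ge0 => i _; apply: sumr_ge0.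
  apply: ler_prod => i _; rewrite sumr_ge0 //=.
  rewrite (eq_bigr (fun j : 'I_(deg q + deg p) => `|p`_(j - i) *+ (i <= j)|)).
    exact: ler_sum_coef_shift.
  by move=> j _; rewrite Sylvester_mxE -/(unsplit (inl i)) unsplitK.
apply: ler_prod => i _; rewrite sumr_ge0 //=.
rewrite (eq_bigr (fun j : 'I_(deg q + deg p) => `|q`_(j - i) *+ (i <= j)|)).
  exact: ler_sum_coef_shift.
by move=> j _; rewrite Sylvester_mxE -/(unsplit (inr i)) unsplitK.
Qed.

(** Cauchy-Schwarz against the vector of ones, obtained by summing
    2 a_i a_j <= a_i ^ 2 + a_j ^ 2 over all i and j. *)
Lemma sqr_sum_ler (R : realDomainType) (n : nat) (a : 'I_n -> R) :
  (\sum_i a i) ^+ 2 <= n%:R * \sum_i a i ^+ 2.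
Proof.
rewrite -(ler_pMn2r (isT : 0 < 2)%N) expr2 big_distrlr /=.
have -> : n%:R * (\sum_i a i ^+ 2) *+ 2 =
    \sum_i \sum_j (a i ^+ 2 + a j ^+ 2).
  under [RHS]eq_bigr do rewrite big_split sumr_const card_ord /=.
  rewrite big_split sumr_const card_ord /= -sumrMnl.
  by rewrite sumrMnl mulr2n mulr_natl.
rewrite -sumrMnl; apply: ler_sum => i _; rewrite -sumrMnl.
by apply: ler_sum => j _; rewrite -subr_ge0 addrAC -sqrrB sqr_ge0.
Qed.

Lemma poly_l1norm_le (R : rcfType) (p : {poly int}) :
  p != 0 ->
  (poly_l1norm p)%:~R <= Num.sqrt (deg p).+1%:R * poly_norm R p.
Proof.
move=> p_neq0; rewrite /poly_norm -sqrtrM ?ler0n //.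
have l1_ge0 : 0 <= (poly_l1norm p)%:~R :> R by rewrite ler0z sumr_ge0.
rewrite -[leLHS]ger0_norm // -sqrtr_sqr; apply: ler_wsqrtr.
rewrite /deg -polySpred // /poly_l1norm rmorph_sum /=.
under eq_bigr do rewrite intr_norm.
apply: le_trans (sqr_sum_ler _) _; apply: ler_wpM2l => //.
by apply: ler_sum => i _; rewrite real_normK ?num_real.
Qed.

(** For degrees n, m >= 1 the exponent 2nm - n - m = n(m - 1) + m(n - 1) is
    nonnegative, so the power of 2 only weakens the estimate. *)
Lemma resultant_le_bound (R : rcfType) (u v : {poly int}) :
  (1 < size u)%N -> (1 < size v)%N -> (`|resultant u v|%N)%:R <= bound R u v.
Proof.
move=> u_nc v_nc; rewrite natr_absz.
have u0 : u != 0 by rewrite -size_poly_gt0 ltnW.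
have v0 : v != 0 by rewrite -size_poly_gt0 ltnW.
have u_deg : (0 < deg u)%N by rewrite /deg -subn1 subn_gt0.
have v_deg : (0 < deg v)%N by rewrite /deg -subn1 subn_gt0.
apply: (@le_trans _ _ ((Num.sqrt (deg u).+1%:R * poly_norm R u) ^+ deg v *
                       (Num.sqrt (deg v).+1%:R * poly_norm R v) ^+ deg u)).
  have := ler_norm_resultant u v; rewrite -(ler_int R) => /le_trans; apply.
  rewrite rmorphM !rmorphXn /=.
  have l1_ge0 (w : {poly int}) : 0 <= (poly_l1norm w)%:~R :> R.
    by rewrite ler0z sumr_ge0.
  apply: ler_pM; rewrite ?exprn_ge0 //;
    by rewrite lerXn2r ?nnegrE ?mulr_ge0 ?sqrtr_ge0 ?poly_l1norm_le.
rewrite /bound /=.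
have -> : 2 * (deg u)%:Z * (deg v)%:Z - (deg u)%:Z - (deg v)%:Z
          = (deg u * (deg v).-1 + deg v * (deg u).-1)%N%:Z.
  by move: u_deg v_deg; nia.
rewrite -exprnP.
have sqrtX (n k : nat) : Num.sqrt (n ^ k)%N%:R = Num.sqrt n%:R ^+ k :> R.
  elim: k => [|k IHk]; first by rewrite sqrtr1.
  by rewrite expnS natrM sqrtrM ?ler0n // IHk exprS.
(* Both sides have the same factors, apart from the power of 2 on the right. *)
rewrite natrM sqrtrM ?ler0n // !sqrtX !exprMn -!mulrA mulrCA.
rewrite [leLHS]mulrCA (mulrCA (poly_norm R u ^+ _)).
apply: ler_peMl; last by apply: exprn_ege1; rewrite ler1n.
by rewrite !mulr_ge0 ?exprn_ge0 ?sqrtr_ge0.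
Qed.

(** * Products of distinct primes *)

Lemma nth_prime_le_step (i x p : nat) :
  (nth_prime i <= x)%N -> (x < p)%N -> prime p -> (nth_prime i.+1 <= p)%N.
Proof.
move=> le_ix lt_xp p_pr; rewrite /nth_prime iterS /next_prime.
by case: ex_minnP => m _; apply; rewrite p_pr andbT; apply: leq_ltn_trans lt_xp.
Qed.

(** In increasing order, the i-th of the given primes is at least the i-th
    prime. *)
Lemma primorial_le_prod (s : seq nat) :
  uniq s -> all prime s -> (primorial (size s) <= \prod_(p <- s) p)%N.
Proof.
rewrite -(sort_uniq leq) -(all_sort _ leq) -(size_sort leq) => s_uniq.
rewrite -(perm_big _ (permEl (perm_sort leq s))) /=.
have: sorted ltn (sort leq s).
  by rewrite ltn_sorted_uniq_leq s_uniq sort_sorted //; apply: leq_total.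
move: (sort leq s) => {s s_uniq} s.
(* x stands for the prime preceding s, or 0 at the start. *)
suffices step i x : (nth_prime i <= x)%N -> path ltn x s -> all prime s ->
    (\prod_(i.+1 <= j < i.+1 + size s) nth_prime j <= \prod_(p <- s) p)%N.
  case: s step => [|p s] step s_sorted s_pr.
    by rewrite /primorial !big_nil.
  by apply: (step 0 0) => //=; case/andP: s_pr => /prime_gt0 ->.
elim: s i x => [|p s IHs] i x le_ix /=; first by rewrite addn0 big_geq ?big_nil.
case/andP=> lt_xp p_s /andP[p_pr s_pr].
have le_ip := nth_prime_le_step le_ix lt_xp p_pr.
rewrite big_cons big_ltn ?addnS ?ltnS ?leq_addr // leq_mul //.
exact: IHs le_ip p_s s_pr.
Qed.

Lemma prod_primes_dvd (s : seq nat) (N : nat) :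
  uniq s -> all prime s -> all (dvdn^~ N) s -> (\prod_(p <- s) p %| N)%N.
Proof.
elim: s => [|p s IHs] /=; first by rewrite big_nil dvd1n.
case/andP=> p_s s_uniq /andP[p_pr s_pr] /andP[p_N s_N].
rewrite big_cons Gauss_dvd ?p_N ?IHs // prime_coprime //.
rewrite Euclid_dvd_prod // big_has; apply/hasPn => r rs.
rewrite dvdn_prime2 ?(allP s_pr r rs) //.
by apply: contraNneq p_s => ->.
Qed.

(** * Reduction modulo a prime *)

Lemma deg0_mod_gcdE (q : nat) (u v : {poly int}) :
  deg0 (mod_gcd q u v) = coprimep (red_mod q u) (red_mod q v).
Proof. by rewrite coprimep_def. Qed.

Lemma intr_Fp_eq0 (q : nat) (c : int) :
  prime q -> ((c%:~R : 'F_q) == 0) = (q %| c)%Z.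
Proof. by move=> q_pr; rewrite (dvdz_pcharf (pchar_Fp q_pr)). Qed.

(** Res(u, v) = a u + b v for some a and b in Z[x]; modulo a prime q not
    dividing Res(u, v) this is a Bezout relation with a nonzero constant. *)
Lemma deg0_mod_gcd_resultant (q : nat) (u v : {poly int}) :
  prime q -> (1 < size u)%N -> (1 < size v)%N ->
  ~~ (q %| resultant u v)%Z -> deg0 (mod_gcd q u v).
Proof.
move=> q_pr u_nc v_nc; rewrite -intr_Fp_eq0 // => res_neq0.
have [[a b] _ /= res_ab] := resultant_in_ideal u_nc v_nc.
rewrite deg0_mod_gcdE; apply/Bezout_coprimepP.
exists (red_mod q a, red_mod q b); rewrite /= /red_mod -!rmorphM -rmorphD /=.
by rewrite -res_ab map_polyC /= -size_poly_eq1 size_polyC res_neq0.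
Qed.

(** * Coprimality in Z[x] *)

Lemma zprimitive_const (f : {poly int}) :
  f != 0 -> (size f <= 1)%N -> zprimitive f = 1.
Proof.
move=> f_neq0 /size1_polyC f_c.
have c_neq0 : f`_0 != 0 by rewrite -polyC_eq0 -f_c.
rewrite f_c -[_%:P]mulr1 mul_polyC zprimitiveZ //.
by rewrite zprimitive_monic ?monic1.
Qed.

Lemma zcontents_polyC (c : int) : zcontents c%:P = c.
Proof.
by rewrite -[c%:P]mulr1 mul_polyC zcontentsZ zcontents_monic ?mulr1 ?monic1.
Qed.

Lemma coprimeZXP (f g : {poly int}) :
  coprimeZX f g <-> forall e, dvdZX e f -> dvdZX e g -> dvdZX e 1.
Proof.
split=> [[d [[_ _ d_max] d_unit]] e e_f e_g | f_g].
  have [h d_h] := d_max e e_f e_g.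
  case: d_unit d_h => -> d_h; first by exists h.
  by exists (- h); rewrite mulrN -d_h opprK.
exists 1; split; last by left.
by split=> //; [exists f | exists g]; rewrite mul1r.
Qed.

Lemma cont_gcd_coprimeZX (f g : {poly int}) : coprimeZX f g -> cont_gcd f g = 1.
Proof.
move/coprimeZXP/(_ (cont_gcd f g)%:P) => unit_r.
have r_dvd (h : {poly int}) : (cont_gcd f g %| zcontents h)%Z ->
    dvdZX (cont_gcd f g)%:P h.
  case/dvdzP=> c h_c; exists (c *: zprimitive h).
  by rewrite mul_polyC scalerA mulrC -h_c -zpolyEprim.
have [h r_h] := unit_r (r_dvd f (dvdz_gcdl _ _)) (r_dvd g (dvdz_gcdr _ _)).
have: (cont_gcd f g %| 1)%Z.
  have := congr1 zcontents r_h.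
  rewrite zcontents_monic ?monic1 // zcontentsM zcontents_polyC => r_unit.
  by apply/dvdzP; exists (zcontents h); rewrite mulrC.
by rewrite dvdz1 /cont_gcd /gcdz /= => /eqP ->.
Qed.

Lemma dvdZX_zprimitive (e f : {poly int}) : dvdZX e (zprimitive f) -> dvdZX e f.
Proof.
by case=> h f_h; exists (zcontents f *: h); rewrite -scalerAr -f_h -zpolyEprim.
Qed.

(** If the resultant vanishes, the pseudo-gcd of pp(f) and pp(g) is not
    constant; by Gauss's lemma its primitive part divides both in Z[x], hence f
    and g. *)
Lemma resultant_coprimeZX (f g : {poly int}) :
  coprimeZX f g -> resultant (zprimitive f) (zprimitive g) != 0.
Proof.
move/coprimeZXP => f_g; apply/negP; rewrite resultant_eq0 => d_nc.
set d := gcdp _ _ in d_nc.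
have d_dvd (h : {poly int}) : d %| zprimitive h -> dvdZX (zprimitive d) h.
  by case/dvdpP_int=> r h_r; apply: dvdZX_zprimitive; exists r.
have [h d_h] := f_g _ (d_dvd f (dvdp_gcdl _ _)) (d_dvd g (dvdp_gcdr _ _)).
have: zprimitive d %| 1 by rewrite d_h dvdp_mulr.
by rewrite dvdp1 size_zprimitive => /eqP d1; rewrite d1 in d_nc.
Qed.

(** A common divisor e of f and g keeps its degree modulo q, as its leading
    coefficient divides w; so e is constant, and it divides r. *)
Lemma coprimeZX_mod (f g : {poly int}) (q : nat) :
  f != 0 -> prime q -> ~~ (q%:Z %| lead_gcd f g)%Z ->
  cont_gcd f g = 1 \/ cont_gcd f g = -1 ->
  deg0 (mod_gcd q (zprimitive f) (zprimitive g)) -> coprimeZX f g.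
Proof.
move=> f_neq0 q_pr q_lead r_unit; rewrite deg0_mod_gcdE => coprime_q.
apply/coprimeZXP=> e [a f_a] [b g_b].
have lead_neq0 : ~~ (q %| lead_coef (zprimitive e))%Z.
  apply: contra q_lead => q_e.
  have q_le : (q %| lead_coef e)%Z.
    by rewrite [e]zpolyEprim lead_coefZ dvdz_mull.
  by rewrite dvdz_gcd f_a g_b !lead_coefM !dvdz_mulr.
have size_red : size (red_mod q (zprimitive e)) = size e.
  by rewrite size_map_poly_id0 ?size_zprimitive // intr_Fp_eq0.
have e1 : (size e <= 1)%N.
  rewrite -size_red -[X in (_ <= X)%N](coprimep_size_gcd coprime_q).
  apply: dvdp_leq; first by rewrite -size_poly_gt0 coprimep_size_gcd.
  by rewrite dvdp_gcd /red_mod f_a g_b !zprimitiveM !rmorphM !dvdp_mulr.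
have := size1_polyC e1; set c := e`_0 => e_c.
have: (c %| cont_gcd f g)%Z.
  by rewrite dvdz_gcd f_a g_b !zcontentsM e_c zcontents_polyC !dvdz_mulr.
have c_unit : (c %| 1)%Z -> dvdZX e 1.
  by case/dvdzP=> b' cb; exists b'%:P; rewrite e_c -polyCM mulrC -cb.
by case: r_unit => ->; rewrite ?dvdzN.
Qed.

(** * The modular criterion *)

Lemma modular_searchE (u v : {poly int}) (qs : seq nat) :
  modular_search u v qs =
    if has (fun q => deg0 (mod_gcd q u v)) qs then Coprime else NotCoprime.
Proof. by elim: qs => //= q qs ->; case: deg0. Qed.

(** Otherwise the product of the k+1 primes would divide the nonzero resultant,
    whose absolute value is less than the product of the first k+1 primes. *)
Lemma has_deg0_mod_gcd (R : rcfType) (f g : {poly int}) (k : nat)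
    (qs : seq nat) :
  f != 0 -> g != 0 ->
  largest_primorial_index (bound R (zprimitive f) (zprimitive g)) k ->
  size qs = k.+1 -> uniq qs -> all prime qs -> coprimeZX f g ->
  has (fun q => deg0 (mod_gcd q (zprimitive f) (zprimitive g))) qs.
Proof.
move=> f_neq0 g_neq0 [_ k_max] qs_size qs_uniq qs_pr /resultant_coprimeZX.
(* A constant primitive polynomial is 1, so the first prime already works. *)
case: (leqP (size f) 1) => [f_c _ | f_nc].
  case: qs qs_size {qs_uniq qs_pr} => //= q qs _.
  by rewrite deg0_mod_gcdE zprimitive_const // /red_mod rmorph1 coprime1p.
case: (leqP (size g) 1) => [g_c _ | g_nc].
  case: qs qs_size {qs_uniq qs_pr} => //= q qs _.
  rewrite deg0_mod_gcdE (zprimitive_const g_neq0) //.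
  by rewrite /red_mod rmorph1 coprimep1.
move: (size_zprimitive f) (size_zprimitive g) k_max.
move: (zprimitive f) (zprimitive g) => u v u_size v_size k_max res_neq0.
apply: contraT => /hasPn no_deg0.
suffices: (primorial k.+1)%:R <= bound R u v by move/k_max; rewrite ltnn.
apply: le_trans (resultant_le_bound R _ _); rewrite ?u_size ?v_size //.
rewrite ler_nat -qs_size; apply: leq_trans (primorial_le_prod qs_uniq qs_pr) _.
apply: dvdn_leq; first by rewrite absz_gt0.
apply: prod_primes_dvd => //; apply/allP => q q_in /=.
rewrite -[q]/`|q%:Z|%N -dvdzE; apply: contraT => q_res.
have := no_deg0 q q_in; rewrite deg0_mod_gcd_resultant ?u_size ?v_size //.
exact: (allP qs_pr).
Qed.

Theorem mainTheorem2 (R : rcfType) (f g : {poly int})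
    (f_neq0 : f != 0) (g_neq0 : g != 0)
    (k : nat)
    (hk : largest_primorial_index (bound R (zprimitive f) (zprimitive g)) k)
    (q : (k.+1).-tuple nat)
    (q_uniq : uniq q)
    (q_prime : forall i : 'I_k.+1, prime (tnth q i))
    (q_ndvd : forall i : 'I_k.+1, ~~ ((tnth q i)%:Z %| lead_gcd f g)%Z) :
  (coprimeZX f g <->
     (cont_gcd f g = 1 \/ cont_gcd f g = -1) /\
     exists i : 'I_k.+1,
       deg0 (mod_gcd (tnth q i) (zprimitive f) (zprimitive g)))
  /\ (coprimality_procedure f g q = Coprime <-> coprimeZX f g)
  /\ (coprimality_procedure f g q = NotCoprime <-> ~ coprimeZX f g).
Proof.
have q_pr : all prime q by apply/all_tnthP.
pose test p := deg0 (mod_gcd p (zprimitive f) (zprimitive g)).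
have crit : coprimeZX f g <->
    (cont_gcd f g = 1 \/ cont_gcd f g = -1) /\ has test q.
  split=> [f_g | [r_unit /(has_tnthP (a := test))[i i_deg0]]].
    split; first by left; apply: cont_gcd_coprimeZX.
    by apply: (has_deg0_mod_gcd f_neq0 g_neq0 hk); rewrite ?size_tuple.
  exact: coprimeZX_mod (q_prime i) (q_ndvd i) r_unit i_deg0.
have run : coprimality_procedure f g q = Coprime <-> coprimeZX f g.
  rewrite /coprimality_procedure modular_searchE; split.
    case: ifP => // /negbT; rewrite negb_and !negbK => /orP r_unit.
    case: ifP => // q_deg0 _; apply/crit; split=> //.
    by case: r_unit => /eqP; [left | right].
  by case/crit=> r_unit ->; case: r_unit => ->.
split; last split=> //.
  rewrite crit; split=> -[r_unit q_deg0]; split=> //.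
    exact: (has_tnthP (a := test)).
  exact/(has_tnthP (a := test)).
case: coprimality_procedure run => run; split=> //.
- by move=> not_fg; case: not_fg; apply/run.
- by move=> _ /run.
Qed.
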